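(* Let $G_1$ and $G_2$ be graphs which both admit a perfect matching, let $e_1\in E(G_1)$ and $e_2\in E(G_2)$, and let $G=G_1(e_1)\#G_2(e_2)$ be a graph obtained by applying a 2-cut connection on $e_1$ and $e_2$. Then $G$ is PMH if and only if, for each $i\in\{1,2\}$, every perfect matching of $G_i$ can be extended to a Hamiltonian cycle of $G_i$ which contains $e_i$.
   Context: The graphs $G_1,G_2$ are finite and connected, may have multiple (parallel) edges, and have no loops; they need not be regular. A perfect matching is the edge set of a $1$-regular spanning subgraph, and a Hamiltonian cycle is a connected $2$-regular spanning subgraph (so two parallel edges form a Hamiltonian cycle of a graph on two vertices). A perfect matching $M$ can be extended to a Hamiltonian cycle $H$ if $M\subseteq E(H)$. A graph admitting a perfect matching is PMH if each of its perfect matchings can be extended to a Hamiltonian cycle. 2-cut connection: let $e_1=x_1y_1\in E(G_1)$ and $e_2=x_2y_2\in E(G_2)$, with $G_1,G_2$ vertex-disjoint. A 2-cut connection on $e_1$ and $e_2$ is the graph $(G_1-e_1)\cup(G_2-e_2)\cup\{x_1x_2,y_1y_2\}$; $G_1(e_1)\#G_2(e_2)$ denotes either this graph or the one obtained by swapping the roles of $x_2$ and $y_2$. *)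

(* Defs.v *)
From mathcomp Require Import all_boot.

Set Implicit Arguments.
Unset Strict Implicit.
Unset Printing Implicit Defensive.

(* Finite loopless multigraphs. Edges are a type of their own, so parallel
   edges are distinct edges having the same pair of end-vertices. *)
Record mgraph := MGraph {
  vert : finType;
  edge : finType;
  ends : edge -> {set vert};
  card_ends : forall e : edge, #|ends e| = 2
}.

(* Spanning subgraphs of G are represented by their edge sets. *)
Definition adj (G : mgraph) (F : {set edge G}) : rel (vert G) :=
  fun u v => [exists e in F, ends e == [set u; v]].

Definition spanning_connected (G : mgraph) (F : {set edge G}) : bool :=
  (0 < #|vert G|) && [forall u, forall v, connect (adj F) u v].

Definition connected (G : mgraph) : bool :=
  spanning_connected [set: edge G].

Definition degree (G : mgraph) (F : {set edge G}) (v : vert G) : nat :=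
  #|[set e in F | v \in ends e]|.

Definition spanning_regular (k : nat) (G : mgraph) (F : {set edge G}) : bool :=
  [forall v, degree F v == k].

Definition perfect_matching (G : mgraph) (M : {set edge G}) : bool :=
  spanning_regular 1 M.

Definition hamiltonian_cycle (G : mgraph) (H : {set edge G}) : bool :=
  spanning_regular 2 H && spanning_connected H.

Definition has_perfect_matching (G : mgraph) : Prop :=
  exists M : {set edge G}, perfect_matching M.

Definition PMH (G : mgraph) : Prop :=
  has_perfect_matching G /\
  forall M : {set edge G}, perfect_matching M ->
    exists2 H : {set edge G}, hamiltonian_cycle H & M \subset H.

(* In the 2-cut connection the vertex set is the disjoint union, and the edges
   are those of G1 - e1, those of G2 - e2, and two new ones: [true] stands for
   x1 x2 and [false] for y1 y2. It is meant to be used when x1, y1 are the ends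
   of e1 and x2, y2 those of e2; the variant with the roles of x2 and y2
   swapped is [two_cut e1 e2 x1 y1 y2 x2]. *)
Section TwoCut.

Variables (G1 G2 : mgraph) (e1 : edge G1) (e2 : edge G2).
Variables (x1 y1 : vert G1) (x2 y2 : vert G2).

Definition two_cut_vert : finType := (vert G1 + vert G2)%type.

Definition two_cut_edge : finType :=
  ({e : edge G1 | e != e1} + {e : edge G2 | e != e2} + bool)%type.

Definition two_cut_ends (e : two_cut_edge) : {set two_cut_vert} :=
  match e with
  | inl (inl f) => [set inl u | u in ends (val f)]
  | inl (inr f) => [set inr u | u in ends (val f)]
  | inr true => [set inl x1; inr x2]
  | inr false => [set inl y1; inr y2]
  end.

Lemma card_two_cut_ends (e : two_cut_edge) : #|two_cut_ends e| = 2.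
Proof.
case: e => [[f|f]|[]]; rewrite /two_cut_ends ?cards2 //.
- by rewrite card_imset ?card_ends // => u v [].
- by rewrite card_imset ?card_ends // => u v [].
Qed.

Definition two_cut : mgraph := MGraph card_two_cut_ends.

End TwoCut.

(* G is one of the two graphs denoted by G1(e1) # G2(e2). *)
Definition two_cut_connection (G1 G2 : mgraph) (e1 : edge G1) (e2 : edge G2)
    (G : mgraph) : Prop :=
  exists (x1 y1 : vert G1) (x2 y2 : vert G2),
    [/\ ends e1 = [set x1; y1], ends e2 = [set x2; y2] &
        G = two_cut e1 e2 x1 y1 x2 y2 \/ G = two_cut e1 e2 x1 y1 y2 x2].

(* Main.v *)
(* Write a subgraph of G as [join F1 F2], where the two new edges together
   stand for e1 and e2. A Hamiltonian cycle meets every cut in a positive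
   even number of edges, so Hamiltonian cycles of G are the joins of
   Hamiltonian cycles of G1 through e1 and of G2 through e2; as |V(G1)| is
   even, perfect matchings of G are likewise the joins of perfect matchings
   M1, M2 such that e1 is in M1 iff e2 is in M2. To extend M1 in G one needs
   an M2 agreeing with it on e2: a Hamiltonian cycle of G2 through e2 that
   extends some perfect matching N gives one, since N and its complement in
   the cycle are both perfect matchings and exactly one of them contains e2. *)
Require Import Defs.
From mathcomp Require Import all_boot.

Set Implicit Arguments.
Unset Strict Implicit.
Unset Printing Implicit Defensive.

(** * Connectivity, degree parity and matchings in multigraphs *)

Section Multigraph.

Variable G : mgraph.
Implicit Types (F H M : {set edge G}) (e : edge G) (u v : vert G).

Lemma adj_sym F : symmetric (adj F).
Proof. by move=> u v; rewrite /adj; under eq_existsb do rewrite setUC. Qed.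

Lemma connect_adj_sym F : connect_sym (adj F).
Proof. exact/sym_connect_sym/adj_sym. Qed.

Lemma adj_edge F e u v : e \in F -> ends e = [set u; v] -> adj F u v.
Proof. by move=> eF euv; apply/existsP; exists e; rewrite eF euv eqxx. Qed.

Lemma connect_edge F e u v :
  e \in F -> u \in ends e -> v \in ends e -> connect (adj F) u v.
Proof.
move=> eF; have /cards2P[a [b [_ eab]]] : #|ends e| == 2 by rewrite card_ends.
have /connect1 ab := adj_edge eF eab.
by rewrite eab => /set2P[] -> /set2P[] -> //; rewrite connect_adj_sym.
Qed.

(** Edges need only go to connected pairs, not to related ones, so [h] may contract vertices or send
    an edge to a detour. *)
Lemma connect_adj_homo (T : finType) (h : vert G -> T) (r : rel T) F :
  (forall e u v, e \in F -> u \in ends e -> v \in ends e -> connect r (h u) (h v)) ->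
  forall u v, connect (adj F) u v -> connect r (h u) (h v).
Proof.
move=> hr u v /connectP[p + ->] {v}.
elim: p u => [|w p IHp] u //= /andP[/exists_inP[e eF /eqP euw] /IHp].
by apply/connect_trans/(hr e); rewrite ?euw ?set21 ?set22.
Qed.

Lemma ends_neq e u v : ends e = [set u; v] -> u != v.
Proof. by move=> euv; have := card_ends e; rewrite euv cards2; case: eqP. Qed.

Lemma degreeE F v : degree F v = \sum_(e in F) (v \in ends e).
Proof. by rewrite /degree -sum1dep_card big_mkcondr. Qed.

Lemma sum_degree F (A : {set vert G}) :
  \sum_(v in A) degree F v = \sum_(e in F) #|ends e :&: A|.
Proof.
under eq_bigr do rewrite degreeE.
rewrite exchange_big; apply: eq_bigr => e _.
by rewrite -sum1_card -big_mkcondr; apply: eq_bigl => v; rewrite inE andbC.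
Qed.

(** An edge contributes 1 if it crosses the cut around [A] and 0 or 2 otherwise, so the sum has the
    parity of the number of crossing edges. *)
Lemma regular_cut_even k F (A : {set vert G}) :
  spanning_regular k F -> ~~ odd (#|A| * k) ->
  ~~ odd (\sum_(e in F) #|ends e :&: A|).
Proof.
move=> /forallP Fk; rewrite -sum_degree.
by rewrite (eq_bigr (fun=> k)) ?sum_nat_const // => v _; apply/eqP.
Qed.

Lemma perfect_matching_order_even M :
  perfect_matching M -> ~~ odd #|vert G|.
Proof.
move=> /forallP M1.
have <- : \sum_(v in [set: vert G]) degree M v = #|vert G|.
  by rewrite (eq_bigr (fun=> 1)) => [|v _]; [rewrite sum1_card cardsT | apply/eqP].
rewrite sum_degree; under eq_bigr do rewrite setIT card_ends.
by rewrite sum_nat_const oddM andbF.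
Qed.

(* If [e] were a bridge, it would be the only edge leaving one side of the
   resulting cut, whereas the degrees on that side have an even sum. *)
Lemma two_regular_no_bridge F e u v :
    spanning_regular 2 F -> e \in F -> ends e = [set u; v] ->
  connect (adj (F :\ e)) u v.
Proof.
move=> F2 eF euv; apply: contraT => nuv.
pose A := [set w | connect (adj (F :\ e)) u w].
have := @regular_cut_even 2 F A F2; rewrite oddM andbF => /(_ isT).
rewrite (bigD1 e) //= oddD.
(* Since [v] lies outside [A], the edge [e] contributes exactly 1. *)
have ->: ends e :&: A = [set u].
  apply/setP=> w; rewrite euv !inE; case: (w =P u) => [->|_] /=.
    by rewrite connect0.
  by case: eqP => // ->; apply/negbTE.
rewrite cards1 /= negbK big_mkcondl.
(* Any other edge of [F] stays within or outside the component [A], so it contributes 2 or 0. *)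
rewrite (_ : odd _ = false) //; apply/negbTE.
elim/big_ind: _ => // [m n|f fe]; first by rewrite oddD => /negbTE-> /negbTE->.
case: ifP => // fF.
have /cards2P[a [b [ab fab]]] : #|ends f| == 2 by rewrite card_ends.
have /connect1 cab : adj (F :\ e) a b by apply: adj_edge fab; rewrite !inE fe.
have eqA : (a \in A) = (b \in A).
  by rewrite !inE (same_connect_r (@connect_adj_sym _) cab).
have [aA|aA] := boolP (a \in A).
  rewrite (setIidPl _) ?card_ends //.
  by apply/subsetP=> w; rewrite fab => /set2P[] ->; rewrite -?eqA.
rewrite (_ : _ :&: _ = set0) ?cards0 //; apply/setP=> w.
rewrite fab in_setI in_set2 in_set0.
by apply/andP=> -[/orP[]/eqP->]; rewrite -?eqA (negbTE aA).
Qed.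

(** Each passage through [e] is replaced by a detour, as [e] is not a bridge. *)
Lemma hamiltonian_cycle_connectD1 H e u v :
  hamiltonian_cycle H -> e \in H -> connect (adj (H :\ e)) u v.
Proof.
case/andP=> H2 /andP[_ /forallP/(_ u)/forallP/(_ v) cH] eH; move: cH.
apply: (connect_adj_homo (h := id)) => {u v} f u v fH.
have [->|fe] := eqVneq f e; last by apply: connect_edge; rewrite !inE fe.
have /cards2P[a [b [_ eab]]] : #|ends e| == 2 by rewrite card_ends.
have ab := two_regular_no_bridge H2 eH eab.
by rewrite eab => /set2P[] -> /set2P[] -> //; rewrite connect_adj_sym.
Qed.

Lemma perfect_matchingD H M :
    spanning_regular 2 H -> perfect_matching M -> M \subset H ->
  perfect_matching (H :\: M).
Proof.
move=> /forallP H2 /forallP M1 MH; apply/forallP=> v.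
have := H2 v; rewrite degreeE (big_setID M) /= (setIidPr MH) -!degreeE.
by rewrite (eqP (M1 v)).
Qed.

Lemma perfect_matching_switch H M e (b : bool) :
    hamiltonian_cycle H -> perfect_matching M -> M \subset H -> e \in H ->
  exists2 N : {set edge G}, perfect_matching N & (e \in N) = b.
Proof.
move=> /andP[H2 _] M1 MH eH.
have [eM|/eqP eM] := eqVneq (e \in M) b; first by exists M.
exists (H :\: M); first exact: perfect_matchingD.
by rewrite inE eH andbT; case: (e \in M) b eM => [] [].
Qed.

End Multigraph.

(** * Subgraphs of the 2-cut connection as joins *)

Section TwoCutJoin.

Variables (G1 G2 : mgraph) (e1 : edge G1) (e2 : edge G2).
Variables (x1 y1 : vert G1) (x2 y2 : vert G2).
Hypotheses (ends_e1 : ends e1 = [set x1; y1]) (ends_e2 : ends e2 = [set x2; y2]).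

Local Notation G := (two_cut e1 e2 x1 y1 x2 y2).

(* Meant for [e1 \in F1] and [e2 \in F2] being equivalent: the two new edges
   jointly stand for both [e1] and [e2]. *)
Definition join (F1 : {set edge G1}) (F2 : {set edge G2}) : {set edge G} :=
  [set f : two_cut_edge e1 e2 | match f with
           | inl (inl g) => val g \in F1
           | inl (inr g) => val g \in F2
           | inr _ => e1 \in F1
           end].

Lemma join_subset (F1 H1 : {set edge G1}) (F2 H2 : {set edge G2}) :
    (e1 \in F1) = (e2 \in F2) -> (e1 \in H1) = (e2 \in H2) ->
  (join F1 F2 \subset join H1 H2) = (F1 \subset H1) && (F2 \subset H2).
Proof.
move=> eF eH; apply/subsetP/andP=> [sFH|[/subsetP s1 /subsetP s2] f].
  (* A new edge tests the inclusion at [e1]; [eF] and [eH] carry it over to [e2]. *)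
  have se : e1 \in F1 -> e1 \in H1 by have := sFH (inr true); rewrite !inE.
  split; apply/subsetP=> f.
    have [-> //|fe] := eqVneq f e1.
    by have := sFH (inl (inl (Sub f fe))); rewrite !inE.
  have [->|fe] := eqVneq f e2; first by rewrite -eF -eH.
  by have := sFH (inl (inr (Sub f fe))); rewrite !inE.
by rewrite !inE; case: f => [[f|f]|_]; [apply: s1 | apply: s2 | apply: s1].
Qed.

Lemma join_surj (F : {set edge G}) : (inr true \in F) = (inr false \in F) ->
  exists (F1 : {set edge G1}) (F2 : {set edge G2}),
    (e1 \in F1) = (e2 \in F2) /\ F = join F1 F2.
Proof.
move=> Fb.
(* [insub] fails only at the deleted edge, which inherits its status from a new edge; by [Fb] both
   new edges have the same one. *)
pose F1 : {set edge G1} := [set f | if insub f is Some g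
  then inl (inl g) \in F else inr true \in F].
pose F2 : {set edge G2} := [set f | if insub f is Some g
  then inl (inr g) \in F else inr true \in F].
have eF1 : (e1 \in F1) = (inr true \in F) by rewrite inE insubF ?eqxx.
have eF2 : (e2 \in F2) = (inr true \in F) by rewrite inE insubF ?eqxx.
exists F1, F2; split; first by rewrite eF1 eF2.
by apply/setP=> -[[f|f]|[]]; rewrite [RHS]inE ?eF1 // inE valK.
Qed.

(** At each end of [e1] exactly one new edge takes the place of [e1], because [x1] and [y1] are
    distinct. *)
Lemma degree_join_inl (F1 : {set edge G1}) (F2 : {set edge G2}) u :
  degree (join F1 F2) (inl u) = degree F1 u.
Proof.
rewrite !degreeE !(big_mkcond (fun e => e \in _)) /=.
rewrite !big_sumType big_bool /= [RHS](bigD1 e1) //= addnC.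
have inl_inj : injective (@inl (vert G1) (vert G2)) by move=> ? ? [].
congr (_ + _); last first.
  rewrite [X in _ + X]big1 ?addn0 => [|f _]; last first.
    by rewrite (_ : inl u \in _ = false) ?if_same //; apply/imsetP=> -[].
  rewrite (big_sub [pred f | f != e1]).
  by apply: eq_bigr => f _; rewrite inE mem_imset.
rewrite !inE ends_e1 !inE; case: ifP => //= _.
have := ends_neq ends_e1.
rewrite !orbF !(inj_eq inl_inj).
by case: (u =P x1) => [->|]; case: (_ =P y1) => // ->; rewrite eqxx.
Qed.

(** Agreement on [e1] and [e2] enters because [join] decides the new edges by [F1]. *)
Lemma degree_join_inr (F1 : {set edge G1}) (F2 : {set edge G2}) u :
    (e1 \in F1) = (e2 \in F2) ->
  degree (join F1 F2) (inr u) = degree F2 u.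
Proof.
move=> eF; rewrite !degreeE !(big_mkcond (fun e => e \in _)) /=.
rewrite !big_sumType big_bool /= [RHS](bigD1 e2) //= addnC.
have inr_inj : injective (@inr (vert G1) (vert G2)) by move=> ? ? [].
congr (_ + _); last first.
  rewrite big1 => [|f _]; last first.
    by rewrite (_ : inr u \in _ = false) ?if_same //; apply/imsetP=> -[].
  rewrite (big_sub [pred f | f != e2]).
  by apply: eq_bigr => f _; rewrite inE mem_imset.
rewrite !inE -eF ends_e2 !inE; case: ifP => //= _.
have := ends_neq ends_e2.
rewrite !(inj_eq inr_inj).
by case: (u =P x2) => [->|]; case: (_ =P y2) => // ->; rewrite eqxx.
Qed.

Lemma spanning_regular_join k (F1 : {set edge G1}) (F2 : {set edge G2}) :
    (e1 \in F1) = (e2 \in F2) ->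
  spanning_regular k (join F1 F2) =
    spanning_regular k F1 && spanning_regular k F2.
Proof.
move=> eF; apply/forallP/andP=> [Fk|[/forallP Fk1 /forallP Fk2] [u|u]].
- split; apply/forallP=> u.
    by have := Fk (inl u); rewrite degree_join_inl.
  by have := Fk (inr u); rewrite degree_join_inr.
- by rewrite degree_join_inl.
- by rewrite degree_join_inr.
Qed.

(** The new edges are the only ones between the two sides, so an even number of them is in [F]. This
    serves matchings ([k = 1]) and cycles ([k = 2]). *)
Lemma two_cut_parity k (F : {set edge G}) :
    spanning_regular k F -> ~~ odd (#|vert G1| * k) ->
  (inr true \in F) = (inr false \in F).
Proof.
move=> Fk evenG1.
pose A : {set vert G} := [set inl u | u in [set: vert G1]].
have inl_inj : injective (@inl (vert G1) (vert G2)) by move=> ? ? [].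
have inlA u : inl u \in A by rewrite mem_imset ?inE.
have inrA u : inr u \in A = false by apply/imsetP=> -[].
have := regular_cut_even (A := A) Fk.
rewrite card_imset // cardsT => /(_ evenG1).
rewrite big_mkcond !big_sumType big_bool /= !oddD.
have cutA b : #|two_cut_ends x1 y1 x2 y2 (inr b : two_cut_edge e1 e2) :&: A| = 1.
  rewrite (_ : _ :&: _ = [set inl (if b then x1 else y1)]) ?cards1 //.
  apply/setP=> -[u|u]; rewrite in_setI ?inlA ?inrA ?andbT ?andbF /=.
    by case: b; rewrite !inE ?orbF.
  by rewrite !inE.
rewrite (cutA true) (cutA false).
(* Old edges of [G1] in [F] contribute 2 each and those of [G2] contribute 0, which leaves the two
   new edges. *)
rewrite (_ : odd (\sum_(f : {e | e != e1}) _) = false); last first.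
  apply/negbTE; elim/big_ind: _ => // [m n|f _].
    by rewrite oddD => /negbTE-> /negbTE->.
  case: ifP => // _; rewrite (setIidPl _) ?(card_ends (inl (inl f) : edge G)) //.
  by apply/subsetP=> w /imsetP[u _ ->].
rewrite big1 => [|f _]; last first.
  case: ifP => // _; apply/eqP; rewrite cards_eq0 setI_eq0.
  by rewrite disjoint_subset; apply/subsetP=> w /imsetP[u _ ->]; rewrite !inE inrA.
by case: (_ \in F) (_ \in F) => [] [].
Qed.

(** * Connectivity and Hamiltonian cycles of joins *)

Lemma connect_join_inl (F1 : {set edge G1}) (F2 : {set edge G2}) u v :
  connect (adj (F1 :\ e1)) u v -> connect (adj (join F1 F2)) (inl u) (inl v).
Proof.
apply: connect_adj_homo => {u v} f u v /setD1P[fe fF] fu fv.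
by apply: (@connect_edge G _ (inl (inl (Sub f fe)))); rewrite ?inE ?imset_f.
Qed.

Lemma connect_join_inr (F1 : {set edge G1}) (F2 : {set edge G2}) u v :
  connect (adj (F2 :\ e2)) u v -> connect (adj (join F1 F2)) (inr u) (inr v).
Proof.
apply: connect_adj_homo => {u v} f u v /setD1P[fe fF] fu fv.
by apply: (@connect_edge G _ (inl (inr (Sub f fe)))); rewrite ?inE ?imset_f.
Qed.

Lemma hamiltonian_cycle_mem (H : {set edge G}) :
  hamiltonian_cycle H -> (inr true \in H) && (inr false \in H).
Proof.
case/andP=> H2 /andP[_ /forallP/(_ (inl x1))/forallP/(_ (inr x2)) cH].
have eqH : (inr true \in H) = (inr false \in H).
  by apply: two_cut_parity H2 _; rewrite oddM andbF.
rewrite -eqH andbb; apply: contraT => nH; move: cH.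
(* Without the new edges, no edge of [H] changes sides, so [x1] could not reach [x2]. *)
pose isl (w : vert G) := if w is inl _ then true else false.
suff cl : closed (adj H) isl by move/(closed_connect cl).
move=> u v /exists_inP[f fH /eqP fuv].
have: (u \in ends f) && (v \in ends f) by rewrite fuv set21 set22.
case: f fH {fuv} => [[f|f] _|[] fH].
- by case/andP=> /imsetP[? _ ->] /imsetP[? _ ->].
- by case/andP=> /imsetP[? _ ->] /imsetP[? _ ->].
- by rewrite fH in nH.
- by rewrite eqH fH in nH.
Qed.

(* Contracting the other side to an end of [e1] maps both new edges into [e1]. *)
Lemma spanning_connected_join_l (F1 : {set edge G1}) (F2 : {set edge G2}) :
  e1 \in F1 -> spanning_connected (join F1 F2) -> spanning_connected F1.
Proof.
move=> eF1 /andP[_ /forallP cF]; apply/andP; split.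
  by apply/card_gt0P; exists x1.
apply/forallP=> u; apply/forallP=> v.
have /forallP/(_ (inl v)) := cF (inl u).
pose h (w : vert G) := if w is inl w' then w' else x1.
apply: (connect_adj_homo (h := h)) => {u v} f u v.
case: f => [[f|f]|b]; rewrite inE => fF.
- by move=> /imsetP[u' fu ->] /imsetP[v' fv ->]; apply: connect_edge fF fu fv.
- by move=> /imsetP[u' _ ->] /imsetP[v' _ ->]; apply: connect0.
have hb w : w \in two_cut_ends x1 y1 x2 y2 (inr b : two_cut_edge e1 e2) ->
    h w \in ends e1.
  by rewrite ends_e1; case: b => /set2P[] ->; rewrite ?set21 ?set22.
by move=> /hb hu /hb hv; apply: connect_edge fF hu hv.
Qed.

(** Symmetrically, [G1] is contracted to [x2], and both new edges land in the ends of [e2]. *)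
Lemma spanning_connected_join_r (F1 : {set edge G1}) (F2 : {set edge G2}) :
    e1 \in F1 -> e2 \in F2 ->
  spanning_connected (join F1 F2) -> spanning_connected F2.
Proof.
move=> eF1 eF2 /andP[_ /forallP cF]; apply/andP; split.
  by apply/card_gt0P; exists x2.
apply/forallP=> u; apply/forallP=> v.
have /forallP/(_ (inr v)) := cF (inr u).
pose h (w : vert G) := if w is inr w' then w' else x2.
apply: (connect_adj_homo (h := h)) => {u v} f u v.
case: f => [[f|f]|b]; rewrite inE => fF.
- by move=> /imsetP[u' _ ->] /imsetP[v' _ ->]; apply: connect0.
- by move=> /imsetP[u' fu ->] /imsetP[v' fv ->]; apply: connect_edge fF fu fv.
have hb w : w \in two_cut_ends x1 y1 x2 y2 (inr b : two_cut_edge e1 e2) ->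
    h w \in ends e2.
  by rewrite ends_e2; case: b => /set2P[] ->; rewrite ?set21 ?set22.
by move=> /hb hu /hb hv; apply: connect_edge eF2 hu hv.
Qed.

Lemma hamiltonian_cycle_join (F1 : {set edge G1}) (F2 : {set edge G2}) :
    e1 \in F1 -> e2 \in F2 ->
  hamiltonian_cycle (join F1 F2) <-> hamiltonian_cycle F1 /\ hamiltonian_cycle F2.
Proof.
move=> eF1 eF2; have eF : (e1 \in F1) = (e2 \in F2) by rewrite eF1 eF2.
split=> [/andP[]|[hF1 hF2]].
  rewrite spanning_regular_join // => /andP[r1 r2] cF; split; apply/andP; split=> //.
    exact: spanning_connected_join_l cF.
  exact: spanning_connected_join_r cF.
(* Both cycles stay connected after losing [e1] and [e2], and the new edge [x1 x2] links them. *)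
have cx1 w : connect (adj (join F1 F2)) (inl x1) w.
  case: w => [u|u]; first exact/connect_join_inl/hamiltonian_cycle_connectD1.
  apply: (@connect_trans _ _ (inr x2)).
    by apply: (@connect_edge G _ (inr true)); rewrite ?inE // ?eqxx ?orbT.
  exact/connect_join_inr/hamiltonian_cycle_connectD1.
case/andP: hF1 hF2 => [r1 _] /andP[r2 _]; apply/andP; split.
  by rewrite spanning_regular_join ?r1.
apply/andP; split; first by apply/card_gt0P; exists (inl x1).
apply/forallP=> u; apply/forallP=> v.
by apply: connect_trans (cx1 v); rewrite connect_adj_sym.
Qed.

(** * The equivalence for one orientation of the connection *)

Lemma PMH_two_cut :
    has_perfect_matching G1 -> has_perfect_matching G2 ->
  PMH G <->
  (forall M : {set edge G1}, perfect_matching M ->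
     exists H : {set edge G1}, [/\ hamiltonian_cycle H, M \subset H & e1 \in H])
  /\
  (forall M : {set edge G2}, perfect_matching M ->
     exists H : {set edge G2}, [/\ hamiltonian_cycle H, M \subset H & e2 \in H]).
Proof.
move=> [N1 pmN1] [N2 pmN2].
have pm_split (M : {set edge G}) : perfect_matching M ->
  exists (M1 : {set edge G1}) (M2 : {set edge G2}),
    [/\ (e1 \in M1) = (e2 \in M2), M = join M1 M2,
        perfect_matching M1 & perfect_matching M2].
  move=> pmM; have /join_surj[M1 [M2 [eM defM]]] : (inr true \in M) = (inr false \in M).
    by apply: two_cut_parity pmM _; rewrite muln1 (perfect_matching_order_even pmN1).
  exists M1, M2; split=> //; move: pmM;
  by rewrite /perfect_matching defM spanning_regular_join // => /andP[].
have pm_join (M1 : {set edge G1}) (M2 : {set edge G2}) :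
    (e1 \in M1) = (e2 \in M2) -> perfect_matching M1 -> perfect_matching M2 ->
  perfect_matching (join M1 M2).
  by move=> eM p1 p2; rewrite /perfect_matching spanning_regular_join //; apply/andP.
split=> [[[M pmM] extG]|[ext1 ext2]].
  have ext (M1 : {set edge G1}) (M2 : {set edge G2}) :
      (e1 \in M1) = (e2 \in M2) -> perfect_matching M1 -> perfect_matching M2 ->
    exists (H1 : {set edge G1}) (H2 : {set edge G2}),
      [/\ hamiltonian_cycle H1, M1 \subset H1 & e1 \in H1] /\
      [/\ hamiltonian_cycle H2, M2 \subset H2 & e2 \in H2].
    move=> eM p1 p2; have [H hH MH] := extG _ (pm_join _ _ eM p1 p2).
    have /andP[Ht Hf] := hamiltonian_cycle_mem hH.
    have [|H1 [H2 [eH defH]]] := @join_surj H; first by rewrite Ht Hf.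
    have eH1 : e1 \in H1 by move: Ht; rewrite defH inE.
    have eH2 : e2 \in H2 by rewrite -eH.
    move: hH MH; rewrite defH join_subset // => /hamiltonian_cycle_join[]// h1 h2.
    by case/andP=> s1 s2; exists H1, H2.
  (* One matching of [G] yields cycles through [e1] and [e2]; switching along them produces a
     compatible partner for any matching of the other side. *)
  have [A1 [A2 [eA _ pA1 pA2]]] := pm_split _ pmM.
  have [B1 [B2 [[hB1 sB1 eB1] [hB2 sB2 eB2]]]] := ext _ _ eA pA1 pA2.
  split=> [M1 pM1|M2 pM2].
    have [M2 pM2 eM] := perfect_matching_switch (e1 \in M1) hB2 pA2 sB2 eB2.
    by have [H1 [H2 [H1P _]]] := ext _ _ (esym eM) pM1 pM2; exists H1.
  have [M1 pM1 eM] := perfect_matching_switch (e2 \in M2) hB1 pA1 sB1 eB1.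
  by have [H1 [H2 [_ H2P]]] := ext _ _ eM pM1 pM2; exists H2.
split=> [|M /pm_split[M1 [M2 [eM -> /ext1[H1 [h1 s1 eH1]] /ext2[H2 [h2 s2 eH2]]]]]].
  (* [N1] and [N2] may disagree on [e1] and [e2], so both are switched to matchings containing these
     edges before joining. *)
  have [H1 [h1 s1 eH1]] := ext1 _ pmN1; have [H2 [h2 s2 eH2]] := ext2 _ pmN2.
  have [M1 p1 eM1] := perfect_matching_switch true h1 pmN1 s1 eH1.
  have [M2 p2 eM2] := perfect_matching_switch true h2 pmN2 s2 eH2.
  by exists (join M1 M2); apply: pm_join; rewrite ?eM1.
exists (join H1 H2); first exact/hamiltonian_cycle_join.
by rewrite join_subset ?s1 ?eH1.
Qed.

End TwoCutJoin.

Theorem theorem4p1 (G1 G2 : mgraph)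
  (conn1 : connected G1) (conn2 : connected G2)
  (pm1 : has_perfect_matching G1) (pm2 : has_perfect_matching G2)
  (e1 : edge G1) (e2 : edge G2)
  (G : mgraph) (defG : two_cut_connection e1 e2 G) :
  PMH G <->
  (forall M : {set edge G1}, perfect_matching M ->
     exists H : {set edge G1}, [/\ hamiltonian_cycle H, M \subset H & e1 \in H])
  /\
  (forall M : {set edge G2}, perfect_matching M ->
     exists H : {set edge G2}, [/\ hamiltonian_cycle H, M \subset H & e2 \in H]).

Proof.
case: defG => x1 [y1 [x2 [y2 [ends1 ends2 [|]->]]]]; apply: PMH_two_cut => //.
(* The swapped variant lists the ends of [e2] in the opposite order. *)
by rewrite setUC.
Qed.
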